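(* Let $\pi_{\rm loc}$ and $\pi_{\rm glo}$ be probability densities on $(0,\infty)$ and let $\zeta>0$. Consider the global-local shrinkage prior on $(\beta_j,\lambda_j)_{j=1}^p$ and $\tau$ given by $\beta_j \mid \tau,\lambda_j \sim \mathcal N(0,\tau^2\lambda_j^2)$, $\lambda_j\sim \pi_{\rm loc}(\cdot)$, $\tau\sim\pi_{\rm glo}(\cdot)$. Introduce fictitious data $z_j$ with $z_j\mid\beta_j,\zeta\sim\mathcal N(\beta_j,\zeta^2)$ and realized value $z_j=0$, $j=1,\dots,p$. Then conditioning on $\boldsymbol z=\boldsymbol 0$ is equivalent to using, given $\tau$ and $\zeta$, the regularized prior $$\pi_{\rm reg}(\beta_j,\lambda_j\mid\tau,\zeta)\propto \exp\!\Big(-\frac{\beta_j^2}{2\zeta^2}\Big)\,\frac{1}{\tau\lambda_j}\exp\!\Big(-\frac{\beta_j^2}{2\tau^2\lambda_j^2}\Big)\,\pi_{\rm loc}(\lambda_j)$$ on $(\beta_j,\lambda_j)$, which yields $$\beta_j\mid\tau,\lambda_j,\zeta,z_j=0\ \sim\ \mathcal N\!\left(0,\Big(\frac1{\zeta^2}+\frac1{\tau^2\lambda_j^2}\Big)^{-1}\right).$$ With $\lambda_j$ marginalized out, $$\pi(\beta_j\mid\tau,\zeta,z_j=0)\ \propto\ \pi(\beta_j\mid\tau)\exp\!\Big(-\frac{\beta_j^2}{2\zeta^2}\Big).$$ Moreover, when data $(\boldsymbol y,\boldsymbol X)$ are observed whose likelihood depends on the parameters only through $\boldsymbol\beta$,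 the posterior full conditional of $(\tau,\boldsymbol\lambda)$ given $\boldsymbol\beta,\zeta,\boldsymbol z=\boldsymbol 0,\boldsymbol y,\boldsymbol X$ equals its conditional given $\boldsymbol\beta$ and has density $$\pi(\tau,\boldsymbol\lambda\mid\boldsymbol\beta)\ \propto\ \pi_{\rm glo}(\tau)\prod_{j}\frac{1}{\tau\lambda_j}\exp\!\Big(-\frac{\beta_j^2}{2\tau^2\lambda_j^2}\Big)\pi_{\rm loc}(\lambda_j).$$
   Context: $\boldsymbol\beta=(\beta_1,\dots,\beta_p)$, $\boldsymbol\lambda=(\lambda_1,\dots,\lambda_p)$, $\boldsymbol z=(z_1,\dots,z_p)$. Conditionally on $\tau$ the pairs $(\beta_j,\lambda_j)$ are independent over $j$; $\boldsymbol z$ is conditionally independent of $(\tau,\boldsymbol\lambda)$ given $(\boldsymbol\beta,\zeta)$, the $z_j$ are conditionally independent given $(\boldsymbol\beta,\zeta)$, and the slab width $\zeta$ is either fixed or given a prior independent of $(\boldsymbol\beta,\boldsymbol\lambda,\tau)$. The density $\pi(\beta_j\mid\tau)=\int_0^\infty \mathcal N(\beta_j;0,\tau^2\lambda^2)\,\pi_{\rm loc}(\lambda)\,d\lambda$ is the marginal under the unregularized prior. Proportionality in the first and third displays is in $(\beta_j,\lambda_j)$ and $\beta_j$ respectively (for fixed $\tau,\zeta$), and in the last display in $(\tau,\boldsymbol\lambda)$ for fixed $\boldsymbol\beta$ (with nonzero coordinates). *)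

(* Defs.v *)
From HB Require Import structures.
From mathcomp Require Import all_boot all_order all_algebra.
From mathcomp Require Import all_classical all_reals all_analysis.

Set Implicit Arguments.
Unset Strict Implicit.
Unset Printing Implicit Defensive.

Import Order.TTheory GRing.Theory Num.Theory.
Import numFieldNormedType.Exports.

Local Open Scope classical_set_scope.
Local Open Scope ring_scope.
Local Open Scope ereal_scope.

Section tuple_cons.
Context d (T : measurableType d) (n : nat).

Definition tuple_cons (x : T * n.-tuple T) : n.+1.-tuple T :=
  [tuple of x.1 :: x.2].

Definition tuple_uncons (t : n.+1.-tuple T) : T * n.-tuple T :=
  (thead t, [tuple of behead t]).

Lemma tuple_consK : cancel tuple_cons tuple_uncons.
Proof. by case=> x t; congr pair; exact/val_inj. Qed.

Lemma tuple_unconsK : cancel tuple_uncons tuple_cons.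
Proof. by move=> t; rewrite [RHS]tuple_eta; exact/val_inj. Qed.

Lemma measurable_tuple_cons : measurable_fun setT tuple_cons.
Proof. exact: measurable_cons. Qed.

Lemma measurable_tuple_uncons : measurable_fun setT tuple_uncons.
Proof.
apply: measurable_fun_pair; first exact: measurable_tnth.
exact: measurable_behead.
Qed.

End tuple_cons.

Section tuple_measure_cons.
Context d (T : measurableType d) (R : realType) (n : nat).
Variables (mu : {sigma_finite_measure set T -> \bar R})
  (mun : {sigma_finite_measure set (n.-tuple T) -> \bar R}).

Definition tuple_measure_cons : set (n.+1.-tuple T) -> \bar R :=
  pushforward (mu \x mun) (@tuple_cons d T n).

Let mcons := @measurable_tuple_cons d T n.

Let tuple_measure_cons0 : tuple_measure_cons set0 = 0.
Proof. by rewrite /tuple_measure_cons /pushforward preimage_set0 measure0. Qed.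

Let tuple_measure_cons_ge0 A : 0 <= tuple_measure_cons A.
Proof. exact: measure_ge0. Qed.

Let tuple_measure_cons_sigma_additive : semi_sigma_additive tuple_measure_cons.
Proof. exact: measure_semi_sigma_additive. Qed.

HB.instance Definition _ := isMeasure.Build _ _ _ tuple_measure_cons
  tuple_measure_cons0 tuple_measure_cons_ge0 tuple_measure_cons_sigma_additive.

Let tuple_measure_cons_sigma_finite : sigma_finite setT tuple_measure_cons.
Proof.
have /sigma_finiteP[F [UF ndF Foo]] := sigma_finiteT mu.
have /sigma_finiteP[G [UG ndG Goo]] := sigma_finiteT mun.
exists (fun k => @tuple_uncons d T n @^-1` (F k `*` G k)).
  rewrite -preimage_bigcup; apply/esym/seteqP; split=> // t _.
  have [i _ Fi] : (\bigcup_i F i) (tuple_uncons t).1 by rewrite -UF.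
  have [j _ Gj] : (\bigcup_j G j) (tuple_uncons t).2 by rewrite -UG.
  exists (maxn i j) => //; split.
    by move: Fi; exact/subsetPset/ndF/leq_maxl.
  by move: Gj; exact/subsetPset/ndG/leq_maxr.
move=> k; have [mF Fkoo] := Foo k; have [mG Gkoo] := Goo k; split.
  rewrite -[X in measurable X]setTI; apply: measurable_tuple_uncons => //.
  exact: measurableX.
rewrite /tuple_measure_cons /pushforward -comp_preimage.
rewrite (_ : _ \o _ = id); last by apply/funext => x; exact: tuple_consK.
by rewrite preimage_id product_measure1E// lte_mul_pinfty// ge0_fin_numE.
Qed.

HB.instance Definition _ := Measure_isSigmaFinite.Build _ _ _
  tuple_measure_cons tuple_measure_cons_sigma_finite.

End tuple_measure_cons.

(* The n-fold product measure mu^n; on 0-tuples it is the unit mass. *)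
Fixpoint tuple_measure d (T : measurableType d) (R : realType)
    (mu : {sigma_finite_measure set T -> \bar R}) (n : nat) :
    {sigma_finite_measure set (n.-tuple T) -> \bar R} :=
  match n with
  | 0 => \d_ [tuple]
  | n'.+1 => tuple_measure_cons mu (tuple_measure mu n')
  end.

Definition lebesgue_tuple (R : realType) (n : nat) :
    {sigma_finite_measure set (n.-tuple (measurableTypeR R)) -> \bar R} :=
  tuple_measure (@lebesgue_measure R) n.

Definition is_density d (T : measurableType d) (R : realType)
    (mu : {measure set T -> \bar R}) (f : T -> R) :=
  [/\ measurable_fun setT f, forall x, (0 <= f x)%R
    & \int[mu]_x (f x)%:E = 1].

(* Densities on (0, +oo) are extended by 0 to the whole line, so that all the
   integrals below range over whole spaces. *)
Definition is_pos_density (R : realType) (f : R -> R) :=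
  is_density (@lebesgue_measure R) (f : measurableTypeR R -> R) /\
  forall x, (x <= 0)%R -> f x = 0%R.

(* f is the probability density (w.r.t. mu) proportional to the kernel k; the
   total mass requirement rules out a kernel with integral 0 or +oo. *)
Definition density_propto d (T : measurableType d) (R : realType)
    (mu : set T -> \bar R) (f k : T -> \bar R) :=
  (exists2 c : R, (0 < c)%R & forall x, f x = c%:E * k x) /\
  \int[mu]_x f x = 1.

(* Conditional density at t, given u, derived from a joint density f (w.r.t. mu
   in its first argument): the ratio of the joint density to its marginal. It
   is a function of the point u, so conditioning on a null event such as z = 0
   makes sense. It is meaningful when the marginal at u is in (0, +oo);
   otherwise the value is 0 or +oo, hence never integrates to 1. *)
Definition cond_density d (T : measurableType d) (U : Type) (R : realType)
    (mu : set T -> \bar R) (f : T -> U -> \bar R) (u : U) (t : T) : \bar R :=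
  f t u / \int[mu]_t' f t' u.

Section model.
Context (R : realType) (ploc pglo : R -> R).
Implicit Types tau zeta b l z : R.
Local Open Scope ring_scope.
Local Notation mu := (@lebesgue_measure R).

(* p(beta_j, lambda_j | tau) *)
Definition prior_pdf tau b l := normal_pdf 0 (tau * l) b * ploc l.

(* p(beta_j | tau); possibly +oo at beta_j = 0 *)
Definition prior_marginal_pdf tau b : \bar R :=
  (\int[mu]_l (prior_pdf tau b l)%:E)%E.

(* p(beta_j, lambda_j, z_j | tau, zeta) *)
Definition augmented_pdf tau zeta b l z :=
  prior_pdf tau b l * normal_pdf b zeta z.

Definition reg_kernel tau zeta b l :=
  expR (- (b ^+ 2 / (2 * zeta ^+ 2))) * (tau * l)^-1 *
  expR (- (b ^+ 2 / (2 * (tau ^+ 2 * l ^+ 2)))) * ploc l.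

(* pi_reg(beta_j, lambda_j | tau, zeta) *)
Definition reg_pdf tau zeta b l : \bar R :=
  ((reg_kernel tau zeta b l)%:E /
   \int[mu \x mu]_x (reg_kernel tau zeta x.1 x.2)%:E)%E.

Section vectors.
Context (p : nat).
Implicit Types bs ls zs : p.-tuple (measurableTypeR R).

(* p(beta, lambda, z | tau, zeta) *)
Definition model_pdf tau zeta bs ls zs :=
  (\prod_(j < p) prior_pdf tau (tnth bs j) (tnth ls j)) *
  \prod_(j < p) normal_pdf (tnth bs j) zeta (tnth zs j).

(* p(tau, zeta, lambda, beta, z, y | X), where lik bs y is the density of y
   given (beta, X). The law nu of zeta is part of the reference measure, so it
   does not contribute a factor. *)
Definition joint_pdf (Y : Type)
    (lik : p.-tuple (measurableTypeR R) -> Y -> R) tau zeta bs ls zs (y : Y) :=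
  pglo tau * model_pdf tau zeta bs ls zs * lik bs y.

(* p(tau, lambda, beta): zeta, z and y are integrated out *)
Definition joint_marginal_pdf dY (Y : measurableType dY)
    (nu : set (measurableTypeR R) -> \bar R) (muY : set Y -> \bar R)
    (lik : p.-tuple (measurableTypeR R) -> Y -> R) tau bs ls : \bar R :=
  (\int[nu]_zeta \int[lebesgue_tuple R p]_zs \int[muY]_y
    (joint_pdf lik tau zeta bs ls zs y)%:E)%E.

Definition full_conditional_kernel tau bs ls :=
  pglo tau * \prod_(j < p) ((tau * tnth ls j)^-1 *
    expR (- (tnth bs j ^+ 2 / (2 * (tau ^+ 2 * tnth ls j ^+ 2)))) *
    ploc (tnth ls j)).

End vectors.
End model.

(* Main.v *)
(* At z = 0 the fictitious likelihood of beta_j is a constant multiple of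
   exp(-beta_j^2 / (2 zeta^2)), so each joint density is a constant multiple of
   the advertised kernel, and conditional densities do not see the constant.
   What needs an argument is that the kernels have total mass in (0, +oo). For
   the regularized prior, integrating out beta_j first gives
   pi_loc(lambda_j) s_j / (tau lambda_j) up to a constant, where the posterior
   deviation s_j is at most tau lambda_j. For the full conditional of
   (tau, lambda), x exp(-x^2 / 2) <= 1 bounds the j-th factor by
   pi_loc(lambda_j) / |beta_j|; this is where beta_j != 0 is used. Since every
   y- and z-density integrates to 1, integrating out y, z and zeta also
   leaves the kernel unchanged up to the same kind of constant. *)
Require Import Defs.
From HB Require Import structures.
From mathcomp Require Import all_boot all_order all_algebra.
From mathcomp Require Import all_classical all_reals all_analysis.
From mathcomp Require Import measurable_realfun ring.

Set Implicit Arguments.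
Unset Strict Implicit.
Unset Printing Implicit Defensive.

Import Order.TTheory GRing.Theory Num.Theory.
Import numFieldNormedType.Exports.

Local Open Scope classical_set_scope.
Local Open Scope ring_scope.

(** * Inversion, a Gaussian bound and quotients in the extended reals *)

Lemma measurable_inv (R : realType) :
  measurable_fun [set: R] (GRing.inv : R -> R).
Proof.
(* Inversion is continuous only away from 0, so the line is cut into the singleton of 0 and its open
   complement. *)
have -> : [set: R] = [set 0] `|` ~` [set 0] by rewrite setUv.
apply/measurable_funU => //; first exact: measurableC.
split; first exact: measurable_fun_set1.
apply: open_continuous_measurable_fun.
  exact: closed_openC (@closed_eq R 0).
by move=> x /[!inE]/= /eqP x0; exact: inv_continuous.
Qed.

(** With [x = |b| / t] this is [x exp(-x^2/2) <= 1]. Taking reciprocals and using [1 + u <= exp u]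
    leaves [|b| <= t + b^2/(2t)], where the gap is a sum of two squares over [2t]. *)
Lemma expR_div_bound (R : realType) (b t : R) : b != 0 -> 0 < t ->
  t^-1 * expR (- (b ^+ 2 / (2 * t ^+ 2))) <= `|b|^-1.
Proof.
move=> b0 t0; have nb0 : 0 < `|b| by rewrite normr_gt0.
rewrite expRN -invfM lef_pV2 ?posrE ?mulr_gt0 ?expR_gt0//.
apply: (@le_trans _ _ (t * (1 + b ^+ 2 / (2 * t ^+ 2)))); last first.
  by rewrite ler_pM2l// expR_ge1Dx.
rewrite -(real_normK (num_real b)) -subr_ge0.
rewrite (_ : _ - _ = ((t - `|b|) ^+ 2 + t ^+ 2) / (2 * t)); last first.
  by field; rewrite gt_eqF.
by rewrite divr_ge0 ?addr_ge0 ?sqr_ge0 ?mulr_ge0// ltW.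
Qed.

(** The degenerate cases agree as well: for [y = +oo] both quotients are 0, and for [y = 0] the
    inverse is [+oo], so both are 0 or [+oo] according to whether [x] is 0. *)
Lemma mule_div2l (R : realType) (c : R) (x y : \bar R) :
  0 < c -> (0 <= x -> 0 <= y -> c%:E * x / (c%:E * y) = x / y)%E.
Proof.
move=> c0; move: y => [y| |] // x0; last first.
  by rewrite gt0_muley ?lte_fin// !invey !mule0.
rewrite lee_fin le_eqVlt => /predU1P[<-|y0].
  rewrite mule0 inve0; move: x0; rewrite le_eqVlt => /predU1P[<-|x0].
    by rewrite mule0 !mul0e.
  by rewrite !gt0_muley// mule_gt0// lte_fin.
rewrite -EFinM !inver !gt_eqF ?mulr_gt0// invfM EFinM.
by rewrite muleACA -EFinM divff ?mul1e// gt_eqF.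
Qed.

(** * Positivity of integrals and normalization of kernels *)

Section integral_facts.
Context d (T : measurableType d) (R : realType).
Context (mu : {measure set T -> \bar R}).
Local Open Scope ereal_scope.

(** If the integral of [g] vanished, [g] would be 0 almost everywhere, hence so would [f]. Applied
    with [f] a probability density, it gives positive mass to any kernel that is positive wherever
    [f] is. *)
Lemma integral_gt0_where (f g : T -> \bar R) :
  measurable_fun setT f -> measurable_fun setT g ->
  (forall x, 0 <= f x) -> (forall x, 0 <= g x) ->
  (forall x, 0 < f x -> 0 < g x) -> 0 < \int[mu]_x f x -> 0 < \int[mu]_x g x.
Proof.
move=> mf mg f0 g0 fg; rewrite !lt0e !integral_ge0// !andbT.
apply: contra => /eqP ig0; apply/eqP; rewrite -ig0; apply/esym.
apply: ge0_ae_eq_integral => //.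
have /(ae_eq_integral_abs _ measurableT mg) : \int[mu]_x `|g x| = 0.
  by under eq_integral do rewrite gee0_abs//.
apply: filterS => x /= /(_ I) gx0 _; rewrite gx0; apply/esym/eqP.
apply: contraTT isT => fx0; have := fg x; rewrite gx0 ltxx.
by rewrite lt0e fx0 f0 => /(_ isT).
Qed.

(** Reduces every conditional density below to a normalized kernel. The constant [c] may depend on
    the conditioning point [u], which is fixed. *)
Lemma cond_density_propto U (f : T -> U -> \bar R) (k : T -> \bar R) u (c : R) :
  (0 < c)%R -> measurable_fun setT k -> (forall t, 0 <= k t) ->
  (forall t, f t u = c%:E * k t) ->
  forall t, cond_density mu f u t = k t / \int[mu]_t' k t'.
Proof.
move=> c0 mk k0 fk t; rewrite /cond_density fk.
under eq_integral do rewrite fk.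
by rewrite ge0_integralZl_EFin ?ltW// mule_div2l// integral_ge0.
Qed.

Lemma density_propto_normalized (k : T -> \bar R) :
  measurable_fun setT k -> (forall t, 0 <= k t) -> 0 < \int[mu]_t k t < +oo ->
  density_propto mu (fun t => k t / \int[mu]_t' k t') k.
Proof.
move=> mk k0 /andP[Z0 Zoo].
have Zfin : \int[mu]_t k t \is a fin_num by rewrite ge0_fin_numE// ltW.
split; last by rewrite ge0_integralZr// ?inve_ge0 ?ltW// divee// gt_eqF.
exists (fine (\int[mu]_t k t))^-1%R.
  by rewrite invr_gt0 fine_gt0// Z0.
move=> x; rewrite -[in LHS](fineK Zfin) inver gt_eqF ?fine_gt0 ?Z0//.
by rewrite muleC.
Qed.

Lemma density_proptoZ (f k k' : T -> \bar R) (c : R) : (0 < c)%R ->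
  (forall x, k x = c%:E * k' x) -> density_propto mu f k ->
  density_propto mu f k'.
Proof.
move=> c0 kk' [[a a0 fk] int1]; split=> //; exists (a * c)%R.
  exact: mulr_gt0.
by move=> x; rewrite fk kk' muleA.
Qed.

End integral_facts.

(** * Factorization of integrals over product measures on tuples *)

Section tuple_measure_integral.
Context d (T : measurableType d) (R : realType).
Local Open Scope ereal_scope.

Lemma emeasurable_prod d' (T' : measurableType d') (I : Type) (s : seq I)
    (h : I -> T' -> \bar R) : (forall i, measurable_fun setT (h i)) ->
  measurable_fun setT (fun x => \prod_(i <- s) h i x).
Proof.
move=> mh; elim: s => [|i s IH]; under eq_fun do rewrite ?big_nil ?big_cons.
  exact: measurable_cst.
exact: emeasurable_funM.
Qed.

(** By induction on [n]: a change of variables along [tuple_cons] splits off the first entry and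
    Tonelli separates it from the tail. For [n = 0] both sides are 1, by the unit mass on the empty
    tuple. *)
Lemma integral_tuple_measure_prod (mu : {sigma_finite_measure set T -> \bar R})
    n (h : 'I_n -> T -> \bar R) :
  (forall i, measurable_fun setT (h i)) -> (forall i x, 0 <= h i x) ->
  \int[tuple_measure mu n]_t \prod_(i < n) h i (tnth t i) =
  \prod_(i < n) \int[mu]_x h i x.
Proof.
elim: n h => [|n IH] h mh h0 /=.
  rewrite big_ord0 integral_dirac//; last first.
    by under eq_fun do rewrite big_ord0; exact: measurable_cst.
  by rewrite diracT mul1e big_ord0.
have mp m (g : 'I_m -> T -> \bar R) : (forall i, measurable_fun setT (g i)) ->
    measurable_fun setT (fun t : m.-tuple T => \prod_(i < m) g i (tnth t i)).
  move=> mg; apply: emeasurable_prod => i.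
  by apply: measurableT_comp => //; exact: measurable_tnth.
rewrite /tuple_measure_cons ge0_integral_pushforward//; last 3 first.
- exact: measurable_tuple_cons.
- exact: mp.
- by move=> t _; exact: prode_ge0.
rewrite preimage_setT /=.
under eq_integral => x _.
  rewrite /= big_ord_recl /tnth0.
  under eq_bigr => i _ do rewrite tnthS.
  over.
rewrite fubini_tonelli1/=; last 2 first.
  apply: emeasurable_funM.
    by apply: measurableT_comp => //; exact: measurable_fst.
  exact: (measurableT_comp (mp _ _ (fun i => mh (lift ord0 i))) measurable_snd).
  by move=> x; rewrite mule_ge0// prode_ge0.
rewrite /fubini_F/=.
transitivity (\int[mu]_x (h ord0 x *
    \prod_(i < n) \int[mu]_x h (lift ord0 i) x)).
  apply: eq_integral => x _; rewrite -IH//.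
  rewrite -[RHS](ge0_integralZl _ _ (mp _ _ (fun i => mh (lift ord0 i))))//.
  by move=> t _; exact: prode_ge0.
rewrite ge0_integralZr// ?big_ord_recl//.
by apply: prode_ge0 => i _; exact: integral_ge0.
Qed.

(** The measure is a product of two tuple measures, whereas each factor couples the [i]-th entries
    of both tuples. The inner integral factors for a fixed first tuple, then the outer one does; a
    last Tonelli recombines each coordinate. *)
Lemma integral_tuple_measure_prod2
    (mu : {sigma_finite_measure set T -> \bar R}) n
    (h : 'I_n -> T * T -> \bar R) :
  (forall i, measurable_fun setT (h i)) -> (forall i x, 0 <= h i x) ->
  \int[tuple_measure mu n \x tuple_measure mu n]_t
    \prod_(i < n) h i (tnth t.1 i, tnth t.2 i) =
  \prod_(i < n) \int[mu \x mu]_x h i x.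
Proof.
move=> mh h0; rewrite fubini_tonelli1/=; last 2 first.
- apply: emeasurable_prod => i; apply: measurableT_comp => //.
  apply: measurable_fun_pair.
    exact: (measurableT_comp (measurable_tnth i) measurable_fst).
  exact: (measurableT_comp (measurable_tnth i) measurable_snd).
- by move=> t; exact: prode_ge0.
transitivity (\int[tuple_measure mu n]_t
    \prod_(i < n) \int[mu]_y h i (tnth t i, y)).
  apply: eq_integral => t _.
  rewrite -(@integral_tuple_measure_prod mu n (fun i y => h i (tnth t i, y)))//.
  move=> i; apply: measurableT_comp => //; exact: measurable_pair1.
rewrite (@integral_tuple_measure_prod mu n (fun i x => \int[mu]_y h i (x, y))).
- by apply: eq_bigr => i _; rewrite fubini_tonelli1.
- by move=> i; exact: measurable_fun_fubini_tonelli_F.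
- by move=> i x; exact: integral_ge0.
Qed.

End tuple_measure_integral.

(** * Gaussian factors and the mass of the regularized kernel *)

Lemma normal_peak1_gt0 (R : realType) : 0 < normal_peak 1 :> R.
Proof. by rewrite normal_peak_gt0// oner_eq0. Qed.

Section gaussian_factors.
Context (R : realType).
Implicit Types m s b l tau zeta : R.

(** [normal_peak 1] is [1 / sqrt(2 pi)]; isolating it leaves the dependence on the scale [s]
    explicit. *)
Lemma normal_pdf_peak1 m s x : 0 < s ->
  normal_pdf m s x =
  normal_peak 1 * (s^-1 * expR (- ((x - m) ^+ 2 / (2 * s ^+ 2)))).
Proof.
move=> s0; rewrite normal_pdfE ?gt_eqF// /normal_peak /normal_fun.
rewrite expr1n mul1r -mulrnAr sqrtrM ?sqr_ge0// sqrtr_sqr gtr0_norm// invfM.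
rewrite mulNr -(mulr_natl (s ^+ 2)).
by rewrite (mulrC s^-1) -mulrA.
Qed.

Context (ploc : R -> R) (hloc : is_pos_density ploc).
Local Notation mu := (@lebesgue_measure R).

Let mloc : measurable_fun [set: R] ploc. Proof. by case: hloc => -[]. Qed.
Let loc_ge0 l : 0 <= ploc l. Proof. by case: hloc => -[]. Qed.
Let int_loc : (\int[mu]_l (ploc l)%:E = 1)%E. Proof. by case: hloc => -[]. Qed.
Let loc_le0 l : l <= 0 -> ploc l = 0. Proof. by case: hloc => _; exact. Qed.

Lemma pos_density_gt0 l : 0 < ploc l -> 0 < l.
Proof. by apply: contraTT; rewrite -!leNgt => /loc_le0 ->. Qed.

(** The factor shared by [reg_kernel] and [full_conditional_kernel]: the prior density without
    [1 / sqrt(2 pi)]. *)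
Definition prior_kernel tau b l :=
  (tau * l)^-1 * expR (- (b ^+ 2 / (2 * (tau ^+ 2 * l ^+ 2)))) * ploc l.

Lemma prior_pdf_kernel tau b l : 0 < tau ->
  prior_pdf ploc tau b l = normal_peak 1 * prior_kernel tau b l.
Proof.
move=> tau0; rewrite /prior_pdf /prior_kernel; have [l0|l0] := ltP 0 l.
  by rewrite normal_pdf_peak1 ?mulr_gt0// subr0 exprMn !mulrA.
(* For [l <= 0] the two Gaussian factors differ, but [ploc l = 0] cancels both sides. *)
by rewrite loc_le0// !mulr0.
Qed.

Lemma reg_kernel_prior tau zeta b l :
  reg_kernel ploc tau zeta b l =
  expR (- (b ^+ 2 / (2 * zeta ^+ 2))) * prior_kernel tau b l.
Proof. by rewrite /reg_kernel /prior_kernel !mulrA. Qed.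

Lemma prior_kernel_ge0 tau b l : 0 < tau -> 0 <= prior_kernel tau b l.
Proof.
move=> tau0; rewrite /prior_kernel; have [l0|l0] := ltP 0 l.
  by rewrite !mulr_ge0 ?expR_ge0// invr_ge0 mulr_ge0// ltW.
by rewrite loc_le0// mulr0.
Qed.

Lemma prior_kernel_gt0 tau b l : 0 < tau -> 0 < ploc l ->
  0 < prior_kernel tau b l.
Proof.
move=> tau0 ploc0; rewrite !mulr_gt0 ?expR_gt0// invr_gt0.
by rewrite mulr_gt0// pos_density_gt0.
Qed.

(** Uniformity of the bound in [tau] keeps the mass finite once [tau] is integrated too. *)
Lemma prior_kernel_le tau b l : b != 0 -> 0 < tau ->
  prior_kernel tau b l <= `|b|^-1 * ploc l.
Proof.
move=> b0 tau0; rewrite /prior_kernel; have [l0|l0] := ltP 0 l.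
  by rewrite ler_wpM2r// -exprMn expR_div_bound// mulr_gt0.
by rewrite loc_le0// !mulr0.
Qed.

Lemma measurable_prior_kernel d (T : measurableType d) (t b l : T -> R) :
  measurable_fun setT t -> measurable_fun setT b -> measurable_fun setT l ->
  measurable_fun setT (fun x => prior_kernel (t x) (b x) (l x)).
Proof.
move=> mt mb ml; apply: measurable_funM; last exact: measurableT_comp.
apply: measurable_funM.
  by apply: (measurableT_comp (@measurable_inv R)); exact: measurable_funM.
apply: measurableT_comp => //; apply: measurableT_comp => //.
apply: measurable_funM; first exact: measurable_funX.
apply: (measurableT_comp (@measurable_inv R)); apply: measurable_funM => //.
by apply: measurable_funM; exact: measurable_funX.
Qed.

Lemma measurable_reg_kernel d (T : measurableType d) tau zeta (b l : T -> R) :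
  measurable_fun setT b -> measurable_fun setT l ->
  measurable_fun setT (fun x => reg_kernel ploc tau zeta (b x) (l x)).
Proof.
move=> mb ml; under eq_fun do rewrite reg_kernel_prior.
apply: measurable_funM; last exact: measurable_prior_kernel.
apply: measurableT_comp => //; apply: measurableT_comp => //.
by apply: measurable_funM => //; exact: measurable_funX.
Qed.

Section fixed_scales.
Context (tau zeta : R) (tau0 : 0 < tau) (zeta0 : 0 < zeta).

Lemma normal_pdf_at0 b :
  normal_pdf b zeta 0 =
  normal_peak 1 * zeta^-1 * expR (- (b ^+ 2 / (2 * zeta ^+ 2))).
Proof. by rewrite normal_pdf_peak1// sub0r sqrrN mulrA. Qed.

Lemma augmented_pdf0 b l :
  augmented_pdf ploc tau zeta b l 0 =
  normal_peak 1 ^+ 2 / zeta * reg_kernel ploc tau zeta b l.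
Proof.
rewrite /augmented_pdf prior_pdf_kernel// normal_pdf_at0 reg_kernel_prior.
by ring.
Qed.

Lemma reg_kernel_ge0 b l : 0 <= reg_kernel ploc tau zeta b l.
Proof. by rewrite reg_kernel_prior mulr_ge0 ?expR_ge0 ?prior_kernel_ge0. Qed.

Definition reg_sd l :=
  Num.sqrt (((zeta ^+ 2)^-1 + (tau ^+ 2 * l ^+ 2)^-1)^-1).

Lemma reg_sd_gt0 l : 0 < reg_sd l.
Proof.
(* The slab precision alone makes the sum positive, even at [l = 0], where the other inverse is 0 by
   convention. *)
rewrite sqrtr_gt0 invr_gt0 ltr_pwDl ?invr_gt0 ?exprn_gt0//.
by rewrite invr_ge0 mulr_ge0 ?sqr_ge0.
Qed.

(* Completing the square: the precisions of the two Gaussian factors add up. *)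
Lemma normal_pdf_product b l : 0 < l ->
  normal_pdf 0 (tau * l) b * normal_pdf b zeta 0 =
  normal_peak 1 * (reg_sd l / (tau * l * zeta)) * normal_pdf 0 (reg_sd l) b.
Proof.
move=> l0; have s0 := reg_sd_gt0 l.
rewrite normal_pdf_at0 !normal_pdf_peak1 ?mulr_gt0// !subr0.
have -> : b ^+ 2 / (2 * reg_sd l ^+ 2) =
    b ^+ 2 / (2 * zeta ^+ 2) + b ^+ 2 / (2 * (tau * l) ^+ 2).
  rewrite /reg_sd sqr_sqrtr; last first.
    by rewrite invr_ge0 addr_ge0 ?invr_ge0 -?exprMn ?sqr_ge0.
  rewrite exprMn !invfM invrK; ring.
by rewrite opprD expRD; field; rewrite !gt_eqF.
Qed.

Lemma reg_kernel_normal b l : 0 < l ->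
  reg_kernel ploc tau zeta b l =
  ploc l * (reg_sd l / (tau * l * normal_peak 1)) * normal_pdf 0 (reg_sd l) b.
Proof.
move=> l0; have c0 : normal_peak 1 != 0 :> R.
  by rewrite gt_eqF// normal_peak1_gt0.
(* Multiplying by the constant of [augmented_pdf0] turns the left side into the joint density at
   [z = 0], to which the Gaussian product formula applies. *)
apply: (@mulfI _ (normal_peak 1 ^+ 2 / zeta)).
  by rewrite mulf_neq0 ?(expf_neq0 _ c0)// invr_neq0// gt_eqF.
rewrite -augmented_pdf0 /augmented_pdf /prior_pdf mulrAC normal_pdf_product//.
by field; rewrite c0 !gt_eqF.
Qed.

Lemma integral_reg_kernel l : 0 < l ->
  (\int[mu]_b (reg_kernel ploc tau zeta b l)%:E =
   (ploc l * (reg_sd l / (tau * l * normal_peak 1)))%:E)%E.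
Proof.
move=> l0; under eq_integral do rewrite reg_kernel_normal// EFinM.
rewrite ge0_integralZl_EFin//.
- by rewrite integral_normal_pdf mule1.
- by move=> b _; rewrite lee_fin normal_pdf_ge0.
- by apply/measurable_EFinP; exact: measurable_normal_pdf.
- by rewrite mulr_ge0// divr_ge0 ?sqrtr_ge0// !mulr_ge0 ?normal_peak_ge0// ltW.
Qed.

(** Adding the slab precision can only lower the prior variance [(tau l)^2]. *)
Lemma reg_sd_le l : 0 < l -> reg_sd l <= tau * l.
Proof.
move=> l0; rewrite -[leRHS]gtr0_norm ?mulr_gt0// -sqrtr_sqr ler_wsqrtr//.
have tl0 : 0 < (tau * l) ^+ 2 by rewrite exprn_gt0 ?mulr_gt0.
rewrite -[leRHS]invrK -exprMn lef_pV2 ?posrE ?invr_gt0//.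
  by rewrite ler_wpDl// invr_ge0 sqr_ge0.
by rewrite ltr_wpDl ?invr_gt0// invr_ge0 sqr_ge0.
Qed.

Lemma reg_kernel_mass :
  (0 < \int[mu \x mu]_x (reg_kernel ploc tau zeta x.1 x.2)%:E < +oo)%E.
Proof.
have c0 := normal_peak1_gt0 R.
have mk : measurable_fun setT (fun x : measurableTypeR R * measurableTypeR R =>
    (reg_kernel ploc tau zeta x.1 x.2)%:E).
  by apply/measurable_EFinP/measurable_reg_kernel.
have k0 (x : measurableTypeR R * measurableTypeR R) :
  (0 <= (reg_kernel ploc tau zeta x.1 x.2)%:E)%E.
  by rewrite lee_fin reg_kernel_ge0.
(* [b] is integrated first: this Gaussian integral is explicit, while integrating [l] first can give
   [+oo] at [b = 0]. *)
rewrite (fubini_tonelli2 _ mk k0).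
have mG := measurable_fun_fubini_tonelli_G (m1 := mu) _ mk k0.
have G0 l : (0 <= fubini_G mu
    (fun x : measurableTypeR R * measurableTypeR R =>
      (reg_kernel ploc tau zeta x.1 x.2)%:E) l)%E.
  by apply: integral_ge0 => b _; exact: k0.
apply/andP; split.
  (* The inner integral is positive wherever [ploc] is, and [ploc] has mass 1. *)
  apply: (@integral_gt0_where _ _ _ mu (fun l => (ploc l)%:E)) => //.
  - exact/measurable_EFinP.
  - move=> l; rewrite lte_fin => ploc0; have l0 := pos_density_gt0 ploc0.
    rewrite /fubini_G/= integral_reg_kernel// lte_fin.
    by rewrite mulr_gt0// divr_gt0 ?reg_sd_gt0// !mulr_gt0.
  - by rewrite int_loc.
(* By [reg_sd_le] the ratio [reg_sd l / (tau l)] is at most 1, which leaves a multiple of [ploc]. *)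
apply: (@le_lt_trans _ _
    (\int[mu]_l ((normal_peak 1)^-1%:E * (ploc l)%:E))%E).
  apply: ge0_le_integral => //.
  - by apply: emeasurable_funM => //; exact/measurable_EFinP.
  - move=> l _; rewrite /fubini_G/= -EFinM; have [l0|l0] := ltP 0 l.
      rewrite integral_reg_kernel// lee_fin mulrC ler_wpM2r//.
      rewrite invfM mulrA ler_piMl ?(invr_ge0 (normal_peak 1)) ?(ltW c0)//.
      by rewrite ler_pdivrMr ?mulr_gt0// mul1r reg_sd_le.
    rewrite integral0_eq; first by rewrite lee_fin mulr_ge0// invr_ge0 ltW.
    by move=> b _; rewrite /reg_kernel loc_le0// mulr0.
rewrite ge0_integralZl_EFin//; first by rewrite int_loc mule1 ltry.
- by move=> l _; exact: loc_ge0.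
- exact/measurable_EFinP.
- by rewrite invr_ge0 ltW.
Qed.

End fixed_scales.
End gaussian_factors.

(** * The regularized prior as the conditional law at [z = 0] *)

Lemma prod_EFin_div (R : realType) (p : nat) (k : 'I_p -> R) (Z : \bar R) :
  (0 < Z < +oo)%E ->
  ((\prod_j k j)%:E / \prod_(j < p) Z = \prod_j ((k j)%:E / Z))%E.
Proof.
(* A mass in [(0, +oo)] moves the identity to the reals, where inverses distribute over products. *)
case: Z => [z /andP[]| |]//; last by rewrite ltxx andbF.
rewrite lte_fin => z0 _.
under [RHS]eq_bigr do rewrite inver gt_eqF// -EFinM.
rewrite !prodEFin inver gt_eqF ?prodr_gt0// -EFinM -prodfV.
by rewrite -big_split.
Qed.

Section regularized_prior.
Context (R : realType) (ploc : R -> R) (hloc : is_pos_density ploc).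
Context (tau zeta : R) (tau0 : 0 < tau) (zeta0 : 0 < zeta).
Local Notation mu := (@lebesgue_measure R).
Local Notation reg_k := (reg_kernel ploc tau zeta).

Let c0 : 0 < normal_peak 1 :> R. Proof. exact: normal_peak1_gt0. Qed.

Let mk : measurable_fun setT (fun x : measurableTypeR R * measurableTypeR R =>
  (reg_k x.1 x.2)%:E).
Proof. by apply/measurable_EFinP/measurable_reg_kernel. Qed.

Let k0 (x : measurableTypeR R * measurableTypeR R) :
  (0 <= (reg_k x.1 x.2)%:E)%E.
Proof. by rewrite lee_fin reg_kernel_ge0. Qed.

Lemma reg_pdf_density_propto :
  density_propto (mu \x mu)%E (fun x => reg_pdf ploc tau zeta x.1 x.2)
    (fun x => (reg_k x.1 x.2)%:E).
Proof.
exact: (density_propto_normalized mk k0 (reg_kernel_mass hloc tau0 zeta0)).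
Qed.

(** At [z = 0] the joint density is a constant times a product of coordinate kernels, each pair
    contributing [normal_peak 1 ^+ 2 / zeta]. The mass factors likewise, so the pairs remain
    independent. *)
Lemma cond_model_pdf p (bs ls : p.-tuple (measurableTypeR R)) :
  cond_density (lebesgue_tuple R p \x lebesgue_tuple R p)%E
    (fun x zs => (model_pdf ploc tau zeta x.1 x.2 zs)%:E)
    [tuple of nseq p (0 : measurableTypeR R)] (bs, ls) =
  (\prod_(j < p) reg_pdf ploc tau zeta (tnth bs j) (tnth ls j))%E.
Proof.
pose T := (p.-tuple (measurableTypeR R) * p.-tuple (measurableTypeR R))%type.
pose k (x : T) := (\prod_(j < p) (reg_k (tnth x.1 j) (tnth x.2 j))%:E)%E.
rewrite (@cond_density_propto _ _ _ (lebesgue_tuple R p \x lebesgue_tuple R p)%E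
  _ _ k _ ((normal_peak 1 ^+ 2 / zeta) ^+ p)); last first.
- move=> [bs' ls']/=; rewrite /k prodEFin -EFinM; congr EFin.
  rewrite /model_pdf -big_split/= -[X in _ ^+ X]card_ord -prodr_const.
  rewrite -big_split/=.
  apply: eq_bigr => j _; rewrite -augmented_pdf0// /augmented_pdf.
  by rewrite tnth_nseq.
- by move=> t; apply: prode_ge0 => j _; rewrite lee_fin reg_kernel_ge0.
- apply: emeasurable_prod => j.
  apply/measurable_EFinP/measurable_reg_kernel => //.
    exact: (measurableT_comp (measurable_tnth j) measurable_fst).
  exact: (measurableT_comp (measurable_tnth j) measurable_snd).
- by rewrite exprn_gt0// divr_gt0// exprn_gt0.
rewrite (@integral_tuple_measure_prod2 _ _ _ mu p
  (fun j x => (reg_k x.1 x.2)%:E))//.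
by rewrite /k prodEFin prod_EFin_div// reg_kernel_mass.
Qed.

Lemma cond_augmented_pdf b l :
  cond_density (mu \x mu)%E
    (fun x z => (augmented_pdf ploc tau zeta x.1 x.2 z)%:E) 0 (b, l) =
  reg_pdf ploc tau zeta b l.
Proof.
rewrite (cond_density_propto (c := normal_peak 1 ^+ 2 / zeta) _ _ mk k0)//.
  by rewrite divr_gt0// exprn_gt0.
by move=> x; rewrite augmented_pdf0.
Qed.

Let mnormal m s : measurable_fun setT
  (fun b : measurableTypeR R => (normal_pdf m s b)%:E).
Proof. by apply/measurable_EFinP; exact: measurable_normal_pdf. Qed.

Let normal_ge0 m s (b : measurableTypeR R) : (0 <= (normal_pdf m s b)%:E)%E.
Proof. by rewrite lee_fin normal_pdf_ge0. Qed.

Lemma cond_beta_hierarchical l b : 0 < l ->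
  cond_density mu
    (fun b z => (normal_pdf 0 (tau * l) b * normal_pdf b zeta z)%:E) 0 b =
  (normal_pdf 0 (reg_sd tau zeta l) b)%:E.
Proof.
move=> l0; have s0 := reg_sd_gt0 tau zeta0 l.
rewrite (cond_density_propto (c := normal_peak 1 *
    (reg_sd tau zeta l / (tau * l * zeta)))
  _ _ (mnormal 0 (reg_sd tau zeta l)) (@normal_ge0 _ _)).
- by rewrite integral_normal_pdf inve1 mule1.
- by rewrite mulr_gt0// divr_gt0// !mulr_gt0.
- by move=> t; rewrite normal_pdf_product.
Qed.

(** For fixed [l] the density is a Gaussian in [b] up to a constant, positive because [0 < ploc l]
    and the total mass [z] of the kernel is finite and positive. *)
Lemma cond_beta_reg_pdf l b : 0 < ploc l ->
  cond_density mu (fun b l => reg_pdf ploc tau zeta b l) l b =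
  (normal_pdf 0 (reg_sd tau zeta l) b)%:E.
Proof.
move=> ploc0; have l0 := pos_density_gt0 hloc ploc0.
have s0 := reg_sd_gt0 tau zeta0 l.
have := reg_kernel_mass hloc tau0 zeta0.
case E : (integral _ _ _) => [z| |] /andP[]//; rewrite lte_fin => z0 _.
rewrite (cond_density_propto (c := ploc l *
    (reg_sd tau zeta l / (tau * l * normal_peak 1)) / z)
  _ _ (mnormal 0 (reg_sd tau zeta l)) (@normal_ge0 _ _)).
- by rewrite integral_normal_pdf inve1 mule1.
- by rewrite divr_gt0// mulr_gt0// divr_gt0// !mulr_gt0.
- move=> t; rewrite /reg_pdf E inver gt_eqF// -!EFinM reg_kernel_normal//.
  by rewrite mulrAC.
Qed.

Let beta_kernel (b : R) := (\int[mu]_l (reg_k b l)%:E)%E.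

Let mbeta : measurable_fun setT (beta_kernel : measurableTypeR R -> \bar R).
Proof. exact: (measurable_fun_fubini_tonelli_F (m2 := mu) _ mk k0). Qed.

Let mkb (b : R) : measurable_fun setT
  (fun l : measurableTypeR R => (reg_k b l)%:E).
Proof. by apply/measurable_EFinP/measurable_reg_kernel. Qed.

Let beta_ge0 (b : R) : (0 <= beta_kernel b)%E.
Proof. by apply: integral_ge0 => l _; rewrite lee_fin reg_kernel_ge0. Qed.

Let beta_mass :
  (\int[mu]_b beta_kernel b = \int[mu \x mu]_x (reg_k x.1 x.2)%:E)%E.
Proof. by rewrite (fubini_tonelli1 _ mk k0). Qed.

Lemma cond_beta_marginal b :
  cond_density mu
    (fun b z => \int[mu]_l (augmented_pdf ploc tau zeta b l z)%:E)%E 0 b =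
  (beta_kernel b / \int[mu]_b' beta_kernel b')%E.
Proof.
apply: (@cond_density_propto _ _ _ mu _ _ beta_kernel _
    (normal_peak 1 ^+ 2 / zeta)) => //.
  by rewrite divr_gt0// exprn_gt0.
move=> t; rewrite -ge0_integralZl_EFin//.
- by apply: eq_integral => l _; rewrite augmented_pdf0.
- by move=> l _; rewrite lee_fin reg_kernel_ge0.
- by rewrite divr_ge0 ?exprn_ge0 ?ltW.
Qed.

(** By Tonelli [beta_kernel] and the joint kernel have the same mass, so conditioning commutes with
    integrating out [l]. *)
Lemma cond_beta_reg_marginal b :
  cond_density mu
    (fun b z => \int[mu]_l (augmented_pdf ploc tau zeta b l z)%:E)%E 0 b =
  (\int[mu]_l reg_pdf ploc tau zeta b l)%E.
Proof.
rewrite cond_beta_marginal beta_mass /beta_kernel -ge0_integralZr//.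
  by move=> l _; rewrite lee_fin reg_kernel_ge0.
rewrite inve_ge0; exact: integral_ge0.
Qed.

(** The slab factor is free of [l] and leaves the integral. The equalities are in [\bar R] and cover
    points where the marginal is [+oo]. *)
Lemma cond_beta_propto :
  density_propto mu
    (cond_density mu
      (fun b z => \int[mu]_l (augmented_pdf ploc tau zeta b l z)%:E)%E 0)
    (fun b => prior_marginal_pdf ploc tau b *
              (expR (- (b ^+ 2 / (2 * zeta ^+ 2))))%:E)%E.
Proof.
rewrite (funext cond_beta_marginal).
(* The constant undoes the normalization present in [prior_pdf] but not in [reg_kernel]. *)
apply: (@density_proptoZ _ _ _ mu _ beta_kernel _ (normal_peak 1)^-1).
- by rewrite invr_gt0.
- move=> b; rewrite /prior_marginal_pdf.
  under eq_integral do rewrite prior_pdf_kernel// EFinM.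
  rewrite ge0_integralZl_EFin ?ltW//; last 2 first.
  + by move=> l _; rewrite lee_fin prior_kernel_ge0.
  + by apply/measurable_EFinP/measurable_prior_kernel.
  rewrite !muleA -EFinM mulVf ?gt_eqF// mul1e muleC.
  rewrite -ge0_integralZl_EFin ?expR_ge0//.
  + by apply: eq_integral => l _; rewrite reg_kernel_prior.
  + by move=> l _; rewrite lee_fin prior_kernel_ge0.
  + by apply/measurable_EFinP/measurable_prior_kernel.
- apply: (@density_propto_normalized _ _ _ mu beta_kernel) => //.
  by rewrite beta_mass reg_kernel_mass.
Qed.

End regularized_prior.

(** * The full conditional of the global and local scales *)

Section full_conditional.
Context (R : realType) (p : nat) (ploc pglo : R -> R).
Context (hloc : is_pos_density ploc) (hglo : is_pos_density pglo).
Local Notation mu := (@lebesgue_measure R).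
Local Notation mup := (lebesgue_tuple R p).
Local Notation vec := (p.-tuple (measurableTypeR R)).
Local Notation full_k := (full_conditional_kernel ploc pglo).

Let c0 : 0 < normal_peak 1 :> R. Proof. exact: normal_peak1_gt0. Qed.

Let mglo : measurable_fun [set: R] pglo. Proof. by case: hglo => -[]. Qed.
Let glo_ge0 t : 0 <= pglo t. Proof. by case: hglo => -[]. Qed.

Lemma full_conditional_kernelE tau (bs ls : vec) :
  full_k tau bs ls =
  pglo tau * \prod_(j < p) prior_kernel ploc tau (tnth bs j) (tnth ls j).
Proof. by []. Qed.

Lemma full_conditional_kernel_ge0 tau (bs ls : vec) : 0 <= full_k tau bs ls.
Proof.
rewrite full_conditional_kernelE; have [tau0|tau0] := ltP 0 tau.
  by rewrite mulr_ge0// prodr_ge0// => j _; exact: prior_kernel_ge0.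
by case: hglo => _ /(_ _ tau0) ->; rewrite mul0r.
Qed.

Lemma measurable_full_conditional_kernel (bs : vec) : measurable_fun setT
  (fun x : measurableTypeR R * vec => (full_k x.1 bs x.2)%:E).
Proof.
apply/measurable_EFinP; apply: measurable_funM.
  exact: (measurableT_comp mglo measurable_fst).
apply: measurable_prod => j _; apply: measurable_prior_kernel => //.
exact: (measurableT_comp (measurable_tnth j) measurable_snd).
Qed.

(** The factors in [zs] and [y] involve neither [tau] nor [ls]. For [tau <= 0] both sides vanish
    with [pglo tau]. *)
Lemma joint_pdf_full_conditional (Y : Type) (lik : vec -> Y -> R) tau zeta
    (bs ls zs : vec) y :
  joint_pdf ploc pglo lik tau zeta bs ls zs y =
  normal_peak 1 ^+ p * full_k tau bs ls *
  (\prod_(j < p) normal_pdf (tnth bs j) zeta (tnth zs j)) * lik bs y.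
Proof.
rewrite /joint_pdf /model_pdf full_conditional_kernelE.
have [tau0|tau0] := ltP 0 tau; last first.
  by case: hglo => _ /(_ _ tau0) ->; rewrite !(mul0r, mulr0).
under eq_bigr do rewrite prior_pdf_kernel//.
by rewrite big_split/= prodr_const card_ord; ring.
Qed.

Lemma joint_marginal_full_conditional (dY : measure_display)
    (Y : measurableType dY) (nu : probability (measurableTypeR R) R)
    (muY : {sigma_finite_measure set Y -> \bar R}) (lik : vec -> Y -> R) tau
    (bs ls : vec) : is_density muY (lik bs) ->
  joint_marginal_pdf ploc pglo nu muY lik tau bs ls =
  ((normal_peak 1 ^+ p)%:E * (full_k tau bs ls)%:E)%E.
Proof.
move=> [mlik lik0 int_lik]; rewrite /joint_marginal_pdf.
have a0 : 0 <= normal_peak 1 ^+ p * full_k tau bs ls.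
  by rewrite mulr_ge0 ?exprn_ge0 ?(ltW c0) ?full_conditional_kernel_ge0.
(* The two inner integrals do not depend on [zeta], so [nu] contributes its total mass 1. *)
transitivity (\int[nu]_z (normal_peak 1 ^+ p * full_k tau bs ls)%:E)%E;
  last first.
  rewrite integral_cst// EFinM -[RHS]mule1; congr (_ * _)%E.
  exact: probability_setT.
apply: eq_integral => zeta _.
transitivity (\int[mup]_zs ((normal_peak 1 ^+ p * full_k tau bs ls)%:E *
    \prod_(j < p) (normal_pdf (tnth bs j) zeta (tnth zs j))%:E))%E.
  apply: eq_integral => zs _.
  under eq_integral do rewrite joint_pdf_full_conditional EFinM.
  rewrite ge0_integralZl_EFin//.
  - by rewrite int_lik mule1 EFinM prodEFin.
  - by move=> y _; rewrite lee_fin.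
  - exact/measurable_EFinP.
  - by rewrite mulr_ge0// prodr_ge0// => j _; exact: normal_pdf_ge0.
rewrite ge0_integralZl_EFin//.
- rewrite (@integral_tuple_measure_prod _ _ _ mu p
    (fun j z => (normal_pdf (tnth bs j) zeta z)%:E)).
  + by rewrite big1 ?mule1// => j _; exact: integral_normal_pdf.
  + by move=> j; apply/measurable_EFinP; exact: measurable_normal_pdf.
  + by move=> j z; rewrite lee_fin normal_pdf_ge0.
- by move=> zs _; apply: prode_ge0 => j _; rewrite lee_fin normal_pdf_ge0.
- apply: emeasurable_prod => j; apply/measurable_EFinP.
  exact: (measurableT_comp (measurable_normal_pdf _ _) (measurable_tnth j)).
Qed.

Lemma full_conditional_mass (bs : vec) : (forall j, tnth bs j != 0) ->
  (0 < \int[mu \x mup]_x (full_k x.1 bs x.2)%:E < +oo)%E.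
Proof.
move=> bs0; have mk := measurable_full_conditional_kernel bs.
have k0 (x : measurableTypeR R * vec) : (0 <= (full_k x.1 bs x.2)%:E)%E.
  by rewrite lee_fin full_conditional_kernel_ge0.
rewrite (fubini_tonelli1 _ mk k0).
have mF := measurable_fun_fubini_tonelli_F (m2 := mup) _ mk k0.
(* For fixed [tau] the kernel is a product over coordinates, so the integral over [ls] factors. *)
have FE (tau : R) : 0 < tau -> fubini_F mup
    (fun x : measurableTypeR R * vec => (full_k x.1 bs x.2)%:E) tau =
  ((pglo tau)%:E * \prod_(j < p)
    \int[mu]_l (prior_kernel ploc tau (tnth bs j) l)%:E)%E.
  move=> tau0; rewrite /fubini_F/=.
  have mq j : measurable_fun setT
    (fun l : measurableTypeR R => (prior_kernel ploc tau (tnth bs j) l)%:E).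
    by apply/measurable_EFinP/measurable_prior_kernel.
  have q0 j (l : measurableTypeR R) :
    (0 <= (prior_kernel ploc tau (tnth bs j) l)%:E)%E.
    by rewrite lee_fin prior_kernel_ge0.
  rewrite -(@integral_tuple_measure_prod _ _ _ mu p
    (fun j l => (prior_kernel ploc tau (tnth bs j) l)%:E))//.
  rewrite -ge0_integralZl_EFin//.
  - by apply: eq_integral => ls _; rewrite prodEFin -EFinM.
  - by move=> ls _; exact: prode_ge0.
  - apply: emeasurable_prod => j.
    exact: (measurableT_comp (mq j) (measurable_tnth j)).
have int_loc : (\int[mu]_l (ploc l)%:E = 1)%E by case: hloc => -[].
have mloc : measurable_fun [set: R] ploc by case: hloc => -[].
have loc_ge0 l : 0 <= ploc l by case: hloc => -[].
have q_gt0 (tau : R) j : 0 < tau ->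
    (0 < \int[mu]_l (prior_kernel ploc tau (tnth bs j) l)%:E)%E.
  move=> tau0; apply: (@integral_gt0_where _ _ _ mu (fun l => (ploc l)%:E)).
  - exact/measurable_EFinP.
  - by apply/measurable_EFinP/measurable_prior_kernel.
  - by move=> l; rewrite lee_fin.
  - by move=> l; rewrite lee_fin prior_kernel_ge0.
  - by move=> l; rewrite !lte_fin; exact: prior_kernel_gt0.
  - by rewrite int_loc.
have q_le (tau : R) j : 0 < tau ->
    (\int[mu]_l (prior_kernel ploc tau (tnth bs j) l)%:E <=
     `|tnth bs j|^-1%:E)%E.
  move=> tau0; rewrite -[leRHS]mule1 -int_loc -ge0_integralZl_EFin//.
  - apply: ge0_le_integral => //.
    + by move=> l _; rewrite lee_fin prior_kernel_ge0.
    + by apply/measurable_EFinP/measurable_prior_kernel.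
    + by apply: emeasurable_funM => //; exact/measurable_EFinP.
    + by move=> l _; rewrite -EFinM lee_fin prior_kernel_le.
  - by move=> l _; rewrite lee_fin.
  - exact/measurable_EFinP.
have int_glo : (\int[mu]_t (pglo t)%:E = 1)%E by case: hglo => -[].
apply/andP; split.
  apply: (@integral_gt0_where _ _ _ mu (fun t => (pglo t)%:E)) => //.
  - exact/measurable_EFinP.
  - by move=> t; apply: integral_ge0 => ls _; exact: k0.
  - move=> t; rewrite lte_fin => pglo0; have t0 := pos_density_gt0 hglo pglo0.
    rewrite FE// mule_gt0//.
    apply: (@big_ind _ (fun x : \bar R => 0 < x)%E) => //.
      by move=> x y; exact: mule_gt0.
    by move=> j _; exact: q_gt0.
  - by rewrite int_glo.
apply: (@le_lt_trans _ _
    (\int[mu]_t ((\prod_(j < p) `|tnth bs j|^-1)%:E * (pglo t)%:E))%E).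
  apply: ge0_le_integral => //.
  - by move=> t _; apply: integral_ge0 => ls _; exact: k0.
  - by apply: emeasurable_funM => //; exact/measurable_EFinP.
  - move=> t _; have [t0|t0] := ltP 0 t.
      rewrite FE// muleC lee_wpmul2r ?lee_fin//.
      rewrite -prodEFin.
      (* Induction on the index list, carrying nonnegativity with the bound, since multiplying
         inequalities in [\bar R] uses both. *)
      suff /(_ (index_enum _)) H : forall r : seq 'I_p, (0 <= \prod_(j <- r)
          \int[mu]_l (prior_kernel ploc t (tnth bs j) l)%:E <=
          \prod_(j <- r) `|tnth bs j|^-1%:E)%E.
        by case/andP: H.
      elim=> [|j r IH]; rewrite ?big_nil ?big_cons ?lee01 ?lexx//.
      have /andP[IH0 IHle] := IH.
      have j0 := ltW (q_gt0 t j t0).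
      apply/andP; split; first exact: mule_ge0.
      by apply: lee_pmul => //; exact: q_le.
    rewrite /fubini_F/= integral0_eq; last first.
      move=> ls _; rewrite full_conditional_kernelE.
      by case: hglo => _ /(_ _ t0) ->; rewrite mul0r.
    by rewrite -EFinM lee_fin mulr_ge0// prodr_ge0.
rewrite ge0_integralZl_EFin//.
- by rewrite int_glo mule1 ltry.
- by move=> l _; rewrite lee_fin.
- exact/measurable_EFinP.
- by rewrite prodr_ge0.
Qed.

End full_conditional.

Theorem proposition2p1 (R : realType) (p : nat) (ploc pglo : R -> R)
    (hloc : is_pos_density ploc) (hglo : is_pos_density pglo)
    (* law of the slab width; a Dirac mass when the width is fixed *)
    (nu : probability (measurableTypeR R) R) (hnu : nu [set` `]0, +oo[] = 1%E)
    (dY : measure_display) (Y : measurableType dY)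
    (muY : {sigma_finite_measure set Y -> \bar R})
    (Xtype : Type) (lik : Xtype -> p.-tuple (measurableTypeR R) -> Y -> R)
    (hlik : forall X bs, is_density muY (lik X bs)) :
  let mu := @lebesgue_measure R in
  let mup := lebesgue_tuple R p in
  let zero := [tuple of nseq p (0 : measurableTypeR R)] in
  (forall tau zeta : R, 0 < tau -> 0 < zeta ->
    (* the regularized prior *)
    [/\ density_propto (mu \x mu)%E
          (fun x => reg_pdf ploc tau zeta x.1 x.2)
          (fun x => (reg_kernel ploc tau zeta x.1 x.2)%:E),
    (* (beta, lambda) given z = 0, tau, zeta *)
        forall bs ls : p.-tuple (measurableTypeR R),
          cond_density (mup \x mup)%E
            (fun x zs => (model_pdf ploc tau zeta x.1 x.2 zs)%:E)
            zero (bs, ls) =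
          (\prod_(j < p) reg_pdf ploc tau zeta (tnth bs j) (tnth ls j))%E,
    (* (beta_j, lambda_j) given z_j = 0, tau, zeta *)
        forall b l : R,
          cond_density (mu \x mu)%E
            (fun x z => (augmented_pdf ploc tau zeta x.1 x.2 z)%:E)
            0 (b, l) =
          reg_pdf ploc tau zeta b l,
    (* beta_j given lambda_j, z_j = 0, tau, zeta: in the hierarchical model,
       and as the conditional of the regularized prior *)
        forall l b : R, 0 < l ->
          let s := Num.sqrt (((zeta ^+ 2)^-1 + (tau ^+ 2 * l ^+ 2)^-1)^-1) in
          cond_density mu
            (fun b z => (normal_pdf 0 (tau * l) b * normal_pdf b zeta z)%:E)
            0 b = (normal_pdf 0 s b)%:E /\
          (0 < ploc l ->
           cond_density mu (fun b l => reg_pdf ploc tau zeta b l) l b =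
           (normal_pdf 0 s b)%:E)
    (* beta_j given z_j = 0, tau, zeta *)
      & let cond_beta := cond_density mu
          (fun b z => \int[mu]_l (augmented_pdf ploc tau zeta b l z)%:E)%E 0 in
        (forall b, cond_beta b = \int[mu]_l reg_pdf ploc tau zeta b l)%E /\
        density_propto mu cond_beta
          (fun b => prior_marginal_pdf ploc tau b *
                    (expR (- (b ^+ 2 / (2 * zeta ^+ 2))))%:E)%E]) /\
  (forall (X : Xtype) (bs : p.-tuple (measurableTypeR R)),
    (forall j, tnth bs j != 0) ->
    (* (tau, lambda) given beta *)
    let cond_tau_lambda := cond_density (mu \x mup)%E
      (fun x bs => joint_marginal_pdf ploc pglo nu muY (lik X) x.1 bs x.2)
      bs in
    density_propto (mu \x mup)%E cond_tau_lambda
      (fun x => (full_conditional_kernel ploc pglo x.1 bs x.2)%:E) /\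
    (* (tau, lambda) given beta, zeta, z = 0, y, X *)
    forall (zeta : R) (y : Y), 0 < zeta -> 0 < lik X bs y ->
      cond_density (mu \x mup)%E
        (fun x (u : R * p.-tuple (measurableTypeR R)
                    * p.-tuple (measurableTypeR R) * Y) =>
          let: (zeta, zs, bs, y) := u in
          (joint_pdf ploc pglo (lik X) x.1 zeta bs x.2 zs y)%:E)
        (zeta, zero, bs, y) = cond_tau_lambda).
Proof.
move=> mu mup zero; split=> [tau zeta tau0 zeta0|X bs bs0 cond_tau_lambda].
  split.
  - exact: reg_pdf_density_propto.
  - by move=> bs ls; exact: cond_model_pdf.
  - by move=> b l; exact: cond_augmented_pdf.
  - move=> l b l0 s; split; first exact: cond_beta_hierarchical.
    exact: cond_beta_reg_pdf.
  - split; first by move=> b; exact: cond_beta_reg_marginal.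
    exact: cond_beta_propto.
have mk := measurable_full_conditional_kernel hloc hglo bs.
pose k (x : measurableTypeR R * p.-tuple (measurableTypeR R)) :=
  (full_conditional_kernel ploc pglo x.1 bs x.2)%:E.
have k0 x : (0 <= k x)%E by rewrite lee_fin full_conditional_kernel_ge0.
have c0 := normal_peak1_gt0 R.
(* Both conditionals will equal the same normalized kernel [k]; only the discarded constants
   differ. *)
have condE : cond_tau_lambda = fun x => (k x / \int[mu \x mup]_x' k x')%E.
  apply/funext; apply: (@cond_density_propto _ _ _ (mu \x mup)%E _ _ k _
    (normal_peak 1 ^+ p)) => //; first exact: exprn_gt0.
  by move=> x; rewrite joint_marginal_full_conditional.
split.
  rewrite condE.
  apply: (@density_propto_normalized _ _ _ (mu \x mup)%E k) => //.
  exact: full_conditional_mass.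
move=> zeta y zeta0 lik0; rewrite condE; apply/funext.
(* [c] gathers all that is free of [tau] and [ls] at the conditioning point; [0 < lik X bs y] makes
   it positive. *)
pose c := normal_peak 1 ^+ p *
  (\prod_(j < p) normal_pdf (tnth bs j) zeta (tnth zero j)) * lik X bs y.
apply: (@cond_density_propto _ _ _ (mu \x mup)%E _ _ k _ c) => //.
  rewrite !mulr_gt0 ?exprn_gt0// prodr_gt0// => j _.
  by rewrite normal_pdf_peak1// mulr_gt0// mulr_gt0 ?expR_gt0// invr_gt0.
move=> x; rewrite (joint_pdf_full_conditional hloc hglo) /k /c.
transitivity (c * full_conditional_kernel ploc pglo x.1 bs x.2)%:E => //.
by rewrite /c; congr EFin; ring.
Qed.
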